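(* Let $X$ be a finite set, let $\langle X, \phi \rangle$ be a closure system on $X$, and let $F$ be the family of closed sets associated with $\langle X, \phi \rangle$. Let $\Sigma$ be a set of implications on $X$, and let $F_\Sigma$ be the family of all subsets of $X$ that obey every implication in $\Sigma$ (the family of closed sets associated with $\Sigma$). Then $F_\Sigma = F$ if and only if the following two conditions hold: (1) For every implication $(A \rightarrow B) \in \Sigma$, $B \subseteq \phi(A)$. (2) For every quasi-closed set $Q$ associated with $\langle X, \phi \rangle$, there exists an implication $(A \rightarrow B) \in \Sigma$ such that $A \subseteq Q$ and $B \not\subseteq Q$.
   Context: A closure system $\langle X, \phi \rangle$ is a nonempty set $X$ equipped with a closure operator $\phi: \mathcal{P}(X) \to \mathcal{P}(X)$, i.e. a map such that for all $A, B \subseteq X$: $A \subseteq \phi(A)$; $A \subseteq B$ implies $\phi(A) \subseteq \phi(B)$; and $\phi(\phi(A)) = \phi(A)$. A set $A \subseteq X$ is closed if $A = \phi(A)$; the family $F$ of closed sets contains $X$ and is closed under intersection. An implication on $X$ is an ordered pair of sets $A, B \subseteq X$, denoted $A \rightarrow B$. A set $S \subseteq X$ obeys $A \rightarrow B$ if $A \not\subseteq S$ or $B \subseteq S$. A set $Q \subseteq X$ is quasi-closed (associated with $\langle X, \phi \rangle$) if $Q \notin F$ and $F \cup \{Q\}$ is still closed under set intersection, i.e. for every $S \in F$, $S \supseteq Q$ or $S \cap Q \in F$. *)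

(* Defs.v *)
From mathcomp Require Import all_boot.

Set Implicit Arguments.
Unset Strict Implicit.
Unset Printing Implicit Defensive.

Definition closure_operator (X : finType) (phi : {set X} -> {set X}) : Prop :=
  [/\ forall A : {set X}, A \subset phi A,
      forall A B : {set X}, A \subset B -> phi A \subset phi B
    & forall A : {set X}, phi (phi A) = phi A].

Definition closure_system (X : finType) (phi : {set X} -> {set X}) : Prop :=
  0 < #|X| /\ closure_operator phi.

Definition closed_sets (X : finType) (phi : {set X} -> {set X}) :
    {set {set X}} :=
  [set A : {set X} | A == phi A].

(* The pair (A, B) stands for the implication A -> B. *)
Definition implication (X : finType) : finType := ({set X} * {set X})%type.

Definition obeys (X : finType) (S : {set X}) (i : implication X) : bool :=
  ~~ (i.1 \subset S) || (i.2 \subset S).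

Definition closed_sets_of_implications (X : finType)
    (Sigma : {set implication X}) : {set {set X}} :=
  [set S : {set X} | [forall i in Sigma, obeys S i]].

Definition closed_under_intersection (X : finType) (F : {set {set X}}) : Prop :=
  forall A B : {set X}, A \in F -> B \in F -> A :&: B \in F.

Definition quasi_closed (X : finType) (phi : {set X} -> {set X})
    (Q : {set X}) : Prop :=
  Q \notin closed_sets phi /\
  closed_under_intersection (closed_sets phi :|: [set Q]).

Lemma closed_setsI (X : finType) (phi : {set X} -> {set X}) :
  closure_operator phi -> closed_under_intersection (closed_sets phi).
Proof.
move=> [ext mono _] A B; rewrite !inE => /eqP cA /eqP cB.
rewrite eqEsubset ext /= subsetI {2}cA {3}cB.
by rewrite !mono ?subsetIl ?subsetIr.
Qed.

Lemma quasi_closedP (X : finType) (phi : {set X} -> {set X}) (Q : {set X}) :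
  closure_system phi ->
  quasi_closed phi Q <->
  Q \notin closed_sets phi /\
  forall S : {set X}, S \in closed_sets phi ->
    (Q \subset S) || (S :&: Q \in closed_sets phi).
Proof.
case=> _ /closed_setsI FI; split=> -[nQ QI]; split=> //.
  move=> S FS; have := QI S Q; rewrite in_setU FS in_setU set11 orbT.
  by move=> /(_ isT isT) /setUP[-> | /set1P/setIidPr ->]; rewrite ?orbT.
have QS S : S \in closed_sets phi -> S :&: Q \in closed_sets phi :|: [set Q].
  case/QI/orP=> [/setIidPr-> | h]; rewrite in_setU ?h ?set11 ?orbT //.
move=> A B /setUP[FA | /set1P->] /setUP[FB | /set1P->].
- by rewrite in_setU FI.
- exact: QS.
- by rewrite setIC; apply: QS.
- by rewrite setIid in_setU set11 orbT.
Qed.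

(* Main.v *)
Require Import Defs.
From mathcomp Require Import all_boot.

(** The sets obeying [Sigma] form a family closed under intersection, and so do
    the closed sets of [phi]. Condition (1) says exactly that every closed set
    obeys [Sigma], because [phi A] is the least closed set containing [A]. It
    remains to see that condition (2), which only speaks of quasi-closed sets,
    rules out every non-closed set obeying [Sigma]. If such sets exist, take
    one, [Q], minimal for inclusion. Intersecting [Q] with a closed set that
    does not contain it gives a strictly smaller set that still obeys [Sigma],
    hence a closed set by minimality. So [Q] is quasi-closed, and (2) provides
    an implication of [Sigma] that [Q] violates: a contradiction. *)

Lemma closed_sets_of_implicationsP (X : finType) (Sigma : {set implication X})
    (S : {set X}) :
  reflect (forall A B : {set X}, (A, B) \in Sigma -> A \subset S -> B \subset S)
          (S \in closed_sets_of_implications Sigma).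
Proof.
rewrite inE; apply: (iffP forall_inP) => [obS A B /obS | obS [A B] /obS].
  by rewrite /obeys /= => /orP[/negbTE-> |].
by rewrite /obeys /=; case: (A \subset S) => //= ->.
Qed.

Lemma closed_sets_of_implicationsI (X : finType) (Sigma : {set implication X}) :
  closed_under_intersection (closed_sets_of_implications Sigma).
Proof.
move=> S T /closed_sets_of_implicationsP obS /closed_sets_of_implicationsP obT.
apply/closed_sets_of_implicationsP => A B iAB; rewrite !subsetI.
by case/andP=> /(obS _ _ iAB)-> /(obT _ _ iAB)->.
Qed.

(** The closed set [phi A] contains [A], so obeying [A -> B] forces [B] into
    it; conversely any closed set containing [A] contains [phi A]. *)
Lemma closed_sets_obeyP (X : finType) (phi : {set X} -> {set X})
    (Sigma : {set implication X}) :
  closure_operator phi ->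
  closed_sets phi \subset closed_sets_of_implications Sigma <->
  (forall A B : {set X}, (A, B) \in Sigma -> B \subset phi A).
Proof.
case=> ext mono idem; split=> [/subsetP sF A B iAB | sB].
  have /sF/closed_sets_of_implicationsP ob : phi A \in closed_sets phi.
    by rewrite inE idem.
  exact: ob iAB (ext A).
apply/subsetP=> S; rewrite inE => /eqP cS.
apply/closed_sets_of_implicationsP => A B iAB sAS.
by rewrite cS; apply: subset_trans (sB _ _ iAB) (mono _ _ sAS).
Qed.

(** An inclusion-minimal element of [G] outside the closed sets is
    quasi-closed: its trace on a closed set that does not contain it is a
    smaller element of [G]. *)
Lemma quasi_closed_in_larger_family (X : finType) (phi : {set X} -> {set X})
    (G : {set {set X}}) :
  closure_system phi -> closed_under_intersection G ->
  closed_sets phi \subset G -> ~~ (G \subset closed_sets phi) ->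
  exists2 Q : {set X}, Q \in G & quasi_closed phi Q.
Proof.
move=> Hphi GI /subsetP sFG /subsetPn[S GS nFS].
have [|Q /minsetP[/andP[GQ nFQ] minQ]] :=
  @ex_minset _ (fun Q => (Q \in G) && (Q \notin closed_sets phi)).
  by exists S; rewrite GS.
exists Q => //; apply/(quasi_closedP _ Hphi); split=> // T FT.
have [//|nQT /=] := boolP (Q \subset T).
apply: contraR nQT => nFTQ; apply/setIidPr.
by apply: minQ (subsetIr T Q); rewrite nFTQ GI // sFG.
Qed.

Theorem lemma2 (X : finType) (phi : {set X} -> {set X})
    (Hphi : closure_system phi) (Sigma : {set implication X}) :
  closed_sets_of_implications Sigma = closed_sets phi <->
  (forall A B : {set X}, (A, B) \in Sigma -> B \subset phi A) /\
  (forall Q : {set X}, quasi_closed phi Q ->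
     exists A B : {set X},
       [/\ (A, B) \in Sigma, A \subset Q & ~~ (B \subset Q)]).
Proof.
have [_ clo] := Hphi; split=> [eqF | [sB violQ]].
  split=> [|Q [nFQ _]]; first by apply/closed_sets_obeyP; rewrite ?eqF.
  move: nFQ; rewrite -eqF inE => /forall_inPn[[A B] iAB].
  by rewrite /obeys negb_or negbK /= => /andP[sAQ nsBQ]; exists A, B.
have sF : closed_sets phi \subset closed_sets_of_implications Sigma.
  exact/closed_sets_obeyP.
apply/eqP; rewrite eqEsubset sF andbT; apply/negPn/negP => nsF.
have [Q /closed_sets_of_implicationsP obQ /violQ[A [B [iAB sAQ]]]] :=
  quasi_closed_in_larger_family _ _ _ Hphi
    (closed_sets_of_implicationsI _ Sigma) sF nsF.
by rewrite (obQ _ _ iAB sAQ).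
Qed.
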